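(* Let $(X,\tau^{+},\tau^{-})$ be a bitopological space and $\tau^\vee=\tau^{+}\vee\tau^{-}$. Every $\tau^\vee$-connected subset of $X$ is antisymmetrically connected. In particular, for every $x\in X$ the symmetric component of $x$ is contained in the antisymmetric component of $x$.
   Context: A bitopological space $(X,\tau^{+},\tau^{-})$ is a set with two topologies; $\tau^\vee=\tau^{+}\vee\tau^{-}$ denotes the join topology, i.e. the coarsest topology containing both. $(X,\tau^{+},\tau^{-})$ is antisymmetrically connected if there do not exist nonempty subsets $A,B\subseteq X$ with $X=A\cup B$, $A\cap B=\varnothing$, $A$ $\tau^{+}$-open and $B$ $\tau^{-}$-open. A subset $C\subseteq X$ is antisymmetrically connected if it is so with the subspace topologies induced by $\tau^{+}$ and $\tau^{-}$. The symmetric component of $x$ is the connected component of $x$ in $(X,\tau^\vee)$. The antisymmetric component of $x$ is the maximal antisymmetrically connected subset of $X$ containing $x$. *)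

(* Defs.v *)
From mathcomp Require Import all_boot all_classical topology.

Set Implicit Arguments.
Unset Strict Implicit.
Unset Printing Implicit Defensive.

Local Open Scope classical_set_scope.

(* Two library topologies on one carrier: [Topological X] is the type of
   topological structures on [X], so neither is canonical on [X] itself. *)
Record bitopologicalType := Bitopological {
  bitop_sort :> choiceType;
  bitop_pos : Topological bitop_sort;
  bitop_neg : Topological bitop_sort }.

Definition pos_space (X : bitopologicalType) : topologicalType :=
  Topological.Pack (bitop_pos X).

Definition neg_space (X : bitopologicalType) : topologicalType :=
  Topological.Pack (bitop_neg X).

(* [sup_topology] has the union of the two families of open sets as a subbase,
   so this is the coarsest topology containing both. *)
Definition join_space (X : bitopologicalType) : topologicalType :=
  sup_topology (fun b : bool => if b then bitop_pos X else bitop_neg X).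

Definition antisymmetrically_connected (X : bitopologicalType) : Prop :=
  ~ exists A B : set X,
      [/\ A !=set0, B !=set0, [set: X] = A `|` B, A `&` B = set0 &
          open (A : set (pos_space X)) /\ open (B : set (neg_space X))].

(* The library's [subspace C] keeps the carrier [X] and isolates the points
   outside [C]; here the carrier must be [C] itself, with the topologies
   initial for the inclusion. *)
Definition bitop_subspace (X : bitopologicalType) (C : set X) :
    bitopologicalType :=
  @Bitopological (set_type C)
    (Topological.class (initial_topology (set_val : C -> pos_space X)))
    (Topological.class (initial_topology (set_val : C -> neg_space X))).

Definition antisymmetrically_connected_set (X : bitopologicalType)
    (C : set X) : Prop :=
  antisymmetrically_connected (bitop_subspace C).

Definition symmetric_component (X : bitopologicalType) (x : X) : set X :=
  connected_component [set: join_space X] x.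

Definition is_antisymmetric_component (X : bitopologicalType) (x : X)
    (C : set X) : Prop :=
  [/\ C x, antisymmetrically_connected_set C &
      forall D : set X, antisymmetrically_connected_set D -> C `<=` D -> D = C].

(* The default [set0] is never taken: see [antisymmetric_component_unique]. *)
Definition antisymmetric_component (X : bitopologicalType) (x : X) : set X :=
  xget set0 (is_antisymmetric_component x).

Lemma antisymmetrically_connected_setP (X : bitopologicalType) (C : set X) :
  antisymmetrically_connected_set C <->
  forall U V : set X, open (U : set (pos_space X)) ->
    open (V : set (neg_space X)) -> C `<=` U `|` V -> C `&` U `&` V = set0 ->
    C `&` U = set0 \/ C `&` V = set0.
Proof.
split=> [Cc U V oU oV CUV CUV0|Cc [A [B [[a Aa] [b Bb] ABT AB0 [oA oB]]]]].
- have [->|/set0P[u [Cu Uu]]] := eqVneq (C `&` U) set0; first by left.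
  have [->|/set0P[v [Cv Vv]]] := eqVneq (C `&` V) set0; first by right.
  exfalso; apply: Cc; exists (set_val @^-1` U), (set_val @^-1` V); split.
  + by exists (SigSub (mem_set Cu)).
  + by exists (SigSub (mem_set Cv)).
  + by apply/esym/seteqP; split=> // c _; apply: CUV; exact: set_valP.
  + apply/seteqP; split=> // c [Uc Vc].
    have : (C `&` U `&` V) (set_val c) by split=> //; split=> //; exact: set_valP.
    by rewrite CUV0.
  + by split; [exists U|exists V].
- case: oA => U oU UA; case: oB => V oV VB; subst A B.
  case: (Cc U V oU oV) => [c Cc'| | |].
  + by have : [set: C] (SigSub (mem_set Cc')) by []; rewrite ABT.
  + apply/seteqP; split=> // c [[Cc' Uc] Vc].
    have : (set_val @^-1` U `&` set_val @^-1` V) (SigSub (mem_set Cc') : C).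
      by split.
    by rewrite AB0.
  + move=> CU0; have : (C `&` U) (set_val a) by split=> //; exact: set_valP.
    by rewrite CU0.
  + move=> CV0; have : (C `&` V) (set_val b) by split=> //; exact: set_valP.
    by rewrite CV0.
Qed.

Lemma antisymmetric_component_unique (X : bitopologicalType) (x : X) :
  is_antisymmetric_component x (antisymmetric_component x) /\
  forall C : set X, is_antisymmetric_component x C ->
    C = antisymmetric_component x.
Proof.
pose M : set X :=
  \bigcup_(C in [set C : set X | C x /\ antisymmetrically_connected_set C]) C.
have M_max C : C x -> antisymmetrically_connected_set C -> C `<=` M.
  by move=> Cx Cc y Cy; exists C.
have Mx : M x.
  exists [set x] => //; split=> //; apply/antisymmetrically_connected_setP.
  move=> U V _ _ _ UV0.
  have [Ux|nUx] := pselect (U x); [right|left]; apply/seteqP; split=> // y [-> //].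
  by move=> Vx; rewrite -UV0.
have Mc : antisymmetrically_connected_set M.
  apply/antisymmetrically_connected_setP => U V oU oV MUV MUV0.
  have disj C y : C x -> antisymmetrically_connected_set C -> C y -> U y -> V y ->
      False.
    by move=> Cx Cc Cy Uy Vy; have : (M `&` U `&` V) y; [split=> //; split=> //;
       exact: (M_max C)|rewrite MUV0].
  have split_C C : C x -> antisymmetrically_connected_set C ->
      C `&` U = set0 \/ C `&` V = set0.
    move=> Cx Cc; apply: (iffLR (antisymmetrically_connected_setP C)) => //.
      by apply: subset_trans MUV; exact: M_max.
    by apply/seteqP; split=> // y [[Cy Uy] Vy]; exact: (disj C y).
  case: (MUV _ Mx) => [Ux|Vx]; [right|left]; apply/seteqP; split=> // y [].
  - move=> [C [Cx Cc] Cy] Vy; case: (split_C C Cx Cc) => CE.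
      by have : (C `&` U) x by []; rewrite CE.
    by rewrite -CE.
  - move=> [C [Cx Cc] Cy] Uy; case: (split_C C Cx Cc) => CE.
      by rewrite -CE.
    by have : (C `&` V) x by []; rewrite CE.
have M_comp : is_antisymmetric_component x M.
  split=> // D Dc MD; apply/seteqP; split=> //; apply: M_max => //.
  exact: MD.
have comp_M C : is_antisymmetric_component x C -> C = M.
  by move=> [Cx Cc Cmax]; rewrite -(Cmax M Mc)//; exact: M_max.
by rewrite /antisymmetric_component (xget_unique _ M_comp comp_M).
Qed.

(* Main.v *)
Require Import Defs.
From mathcomp Require Import all_boot all_classical topology.

Set Implicit Arguments.
Unset Strict Implicit.
Unset Printing Implicit Defensive.

Local Open Scope classical_set_scope.

(** If a positive-open [U] and a negative-open [V] split [C] into disjoint nonempty traces, both are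
    open for the join, so they also disconnect [C] there. Hence a join-connected set is
    antisymmetrically connected. For components, antisymmetric connectedness survives unions of two
    sets through a common point, so the maximal set at [x] absorbs the symmetric component. *)

Lemma open_sup_topology (T : choiceType) (I : Type) (Tc : I -> Topological T)
    (i : I) (U : set T) :
  open (U : set (Topological.Pack (Tc i))) -> open (U : set (sup_topology Tc)).
Proof.
move=> oU; rewrite openE => t Ut.
(* The neighbourhood filter of [t] in the supremum converges to [t], hence does so in each [Tc i]:
   it contains every [Tc i]-neighbourhood of [t]. *)
have /cvg_sup/(_ i) : nbhs (t : sup_topology Tc) --> (t : sup_topology Tc).
  exact: cvg_id.
by apply; exact: open_nbhs_nbhs.
Qed.

Lemma connected_antisymmetrically_connected (X : bitopologicalType)
    (C : set X) :
  connected (C : set (join_space X)) -> antisymmetrically_connected_set C.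
Proof.
move=> Cc; apply/antisymmetrically_connected_setP => U V oU oV CUV CUV0.
have oU' : open (U : set (join_space X)).
  exact: (open_sup_topology (i := true)).
have oV' : open (V : set (join_space X)).
  exact: (open_sup_topology (i := false)).
have [->|/set0P CU] := eqVneq (C `&` U) set0; [by left|right].
(* Replacing [C] by its trace on [U] turns the goal into [CUV0]. *)
suff <- : C `&` U = C by [].
apply: Cc => //; first by exists U.
(* The trace of [U] is also relatively closed, being what [V] leaves of [C]. *)
exists (~` V); first exact: open_closedC.
apply/seteqP; split=> y [Cy].
- by move=> Uy; split=> // Vy; rewrite -[False]/(set0 y) -CUV0.
- by move=> nVy; split=> //; case: (CUV y Cy).
Qed.

Lemma antisymmetrically_connected_setU (X : bitopologicalType)
    (x : X) (C D : set X) : C x -> D x ->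
  antisymmetrically_connected_set C -> antisymmetrically_connected_set D ->
  antisymmetrically_connected_set (C `|` D).
Proof.
move=> Cx Dx /antisymmetrically_connected_setP Cc.
move=> /antisymmetrically_connected_setP Dc.
apply/antisymmetrically_connected_setP => U V oU oV.
rewrite subUset !setIUl => -[CUV DUV]; rewrite setU_eq0 => -[CUV0 DUV0].
have [CE|CE] := Cc U V oU oV CUV CUV0; have [DE|DE] := Dc U V oU oV DUV DUV0.
- by left; rewrite CE DE setU0.
(* In the mixed cases [C] and [D] lie on opposite sides, but the common point [x] is on one side
   only. *)
- case: (CUV _ Cx) => ?.
    by have : (C `&` U) x by []; rewrite CE.
  by have : (D `&` V) x by []; rewrite DE.
- case: (CUV _ Cx) => ?.
    by have : (D `&` U) x by []; rewrite DE.
  by have : (C `&` V) x by []; rewrite CE.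
- by right; rewrite CE DE setU0.
Qed.

Theorem proposition5p8 (X : bitopologicalType) :
  (forall C : set X, connected (C : set (join_space X)) ->
     antisymmetrically_connected_set C) /\
  (forall x : X, symmetric_component x `<=` antisymmetric_component x).
Proof.
split=> [C|x]; first exact: connected_antisymmetrically_connected.
have [[Mx Mc Mmax] _] := antisymmetric_component_unique x.
have Kx : symmetric_component x x by exact: connected_component_refl.
have Kc : antisymmetrically_connected_set (symmetric_component x).
  apply: connected_antisymmetrically_connected.
  exact: component_connected.
have MKc := antisymmetrically_connected_setU Mx Kx Mc Kc.
(* By maximality the union adds nothing to the antisymmetric component. *)
by rewrite -(Mmax _ MKc (@subsetUl _ _ _)); exact: subsetUr.
Qed.
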